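(* Let $R$ be a commutative ring with $1\neq 0$, let $n\geq 2$, and let $a_1,\dots,a_n\in R$ satisfy $Ra_1+\cdots+Ra_n=R$. Let $S=\{(x_1,\dots,x_n)\in R^n : a_1x_1+\cdots+a_nx_n=0\}$. If $R$ is a $K$-Hermite ring and $i\in\{1,\dots,n\}$, then $S/S_i$ is isomorphic, as an $R$-module, to $(R/Ra_i)^{n-2}$.
   Context: For $1\leq i\neq j\leq n$, $v(i,j)\in S$ is the vector whose $i$th entry is $-a_j$, whose $j$th entry is $a_i$, and whose other entries are $0$. $S_i$ is the $R$-span of all $v(i,j)$ with $j\neq i$. A commutative ring $R$ is a $K$-Hermite ring if for every $m\geq 1$ and every $(b_1,\dots,b_m)\in R^m$ there exist $Q\in\mathrm{GL}_m(R)$ and $d\in R$ such that $(b_1,\dots,b_m)Q=(d,0,\dots,0)$. *)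

(* Defs.v *)
From HB Require Import structures.
From mathcomp Require Import all_boot all_order all_algebra.
From mathcomp Require Import generic_quotient ring_quotient.
From mathcomp Require Import boolp.

Set Implicit Arguments.
Unset Strict Implicit.
Unset Printing Implicit Defensive.

Import GRing.Theory.

Local Open Scope ring_scope.
Local Open Scope quotient_scope.

(* R is only a commutative ring, without decidable units, so unitmx is not
   available and GL_m(R) is given by two-sided inverses. *)
Definition GLmx (R : comNzRingType) (m : nat) (Q : 'M[R]_m) : Prop :=
  exists Q' : 'M[R]_m, Q *m Q' = 1%:M /\ Q' *m Q = 1%:M.

Definition KHermite (R : comNzRingType) : Prop :=
  forall (m : nat) (b : 'rV[R]_m.+1),
    exists (Q : 'M[R]_m.+1) (d : R),
      GLmx Q /\ b *m Q = \row_j (if j == ord0 then d else 0).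

(* The library quotient Quotient.quot is only a zmodType; the scaling by R is added
   here. *)
Section QuotientModule.
Variables (R : pzRingType) (V : lmodType R) (N : submodClosed V).

(* In the library a submodClosed over a ring is not a zmodClosed, although -1 is
   a scalar. *)
Definition zmod_of_submod : {pred V} := [pred x | x \in N].

HB.instance Definition _ := GRing.isZmodClosed.Build V zmod_of_submod
  (GRing.submod_closedB (GRing.submodClosedP N)).

Local Notation zquot := (@Quotient.quot V zmod_of_submod).

Definition quotmod : Type := zquot.

HB.instance Definition _ := Choice.on quotmod.
HB.instance Definition _ := GRing.Zmodule.on quotmod.

Definition quotmod_proj (x : V) : quotmod := \pi_(zquot) x.

Definition quotmod_scale (r : R) (x : quotmod) : quotmod :=
  quotmod_proj (r *: repr (x : zquot)).

Lemma quotmod_projP (x y : V) :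
  quotmod_proj x = quotmod_proj y <-> x - y \in N.
Proof.
have -> : (x - y \in N) = (x - y \in zmod_of_submod) by [].
by rewrite Quotient.idealrBE; split=> /eqP.
Qed.

Lemma quotmod_projE (x : quotmod) :
  quotmod_proj (repr (x : zquot)) = x.
Proof. exact: reprK. Qed.

Lemma quotmod_projD (x y : V) :
  quotmod_proj (x + y) = quotmod_proj x + quotmod_proj y.
Proof. exact: (pi_addr (s := zquot)). Qed.

Lemma quotmod_projZ r (x : V) :
  quotmod_proj (r *: x) = quotmod_scale r (quotmod_proj x).
Proof.
apply/quotmod_projP; rewrite -scalerBr rpredZ //.
by apply/quotmod_projP; rewrite quotmod_projE.
Qed.

Fact quotmod_scaleA r s x :
  quotmod_scale r (quotmod_scale s x) = quotmod_scale (r * s) x.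
Proof. by rewrite -[x]quotmod_projE -!quotmod_projZ scalerA. Qed.

Fact quotmod_scale1 : left_id 1 quotmod_scale.
Proof. by move=> x; rewrite -[x]quotmod_projE -quotmod_projZ scale1r. Qed.

Fact quotmod_scaleDr : right_distributive quotmod_scale +%R.
Proof.
move=> r x y; rewrite -[x]quotmod_projE -[y]quotmod_projE -quotmod_projD.
by rewrite -!quotmod_projZ -quotmod_projD scalerDr.
Qed.

Fact quotmod_scaleDl x : {morph quotmod_scale^~ x : r s / r + s}.
Proof.
move=> r s; rewrite -[x]quotmod_projE -!quotmod_projZ -quotmod_projD.
by rewrite scalerDl.
Qed.

HB.instance Definition _ := GRing.Zmodule_isLmodule.Build R quotmod
  quotmod_scaleA quotmod_scale1 quotmod_scaleDr quotmod_scaleDl.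

Fact quotmod_proj_linear : linear quotmod_proj.
Proof. by move=> r x y; rewrite quotmod_projD quotmod_projZ. Qed.

HB.instance Definition _ := GRing.isLinear.Build R V quotmod _ quotmod_proj
  quotmod_proj_linear.

End QuotientModule.

Section Span.
Variables (R : pzRingType) (V : lmodType R) (I : finType).
Variables (P : pred I) (F : I -> V).

Definition span_of : {pred V} :=
  fun x => `[< exists c : I -> R, x = \sum_(i | P i) c i *: F i >].

Fact span_of_submod : submod_closed span_of.
Proof.
split=> [|r x y /asboolP[c ->] /asboolP[d ->]]; apply/asboolP.
  by exists (fun=> 0); rewrite big1 // => i _; rewrite scale0r.
exists (fun i => r * c i + d i); rewrite scaler_sumr -big_split.
by apply: eq_bigr => i _; rewrite scalerDl scalerA.
Qed.

HB.instance Definition _ := GRing.isSubmodClosed.Build R V span_of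
  (GRing.subsemimod_closed_submod span_of_submod).

End Span.

Section PrincipalIdeal.
Variables (R : pzRingType) (a : R).

Definition principal : {pred R^o} := fun x => `[< exists r : R, x = r * a >].

Fact principal_submod : submod_closed principal.
Proof.
split=> [|r x y /asboolP[c ->] /asboolP[d ->]]; apply/asboolP.
  by exists 0; rewrite mul0r.
by exists (r * c + d); rewrite mulrDl -mulrA.
Qed.

HB.instance Definition _ := GRing.isSubmodClosed.Build R R^o principal
  (GRing.subsemimod_closed_submod principal_submod).

End PrincipalIdeal.

Section Syzygies.
Variables (R : comNzRingType) (n : nat) (a : 'I_n -> R).

Definition is_syz : {pred 'rV[R]_n} := fun x => \sum_j a j * x 0 j == 0.

Fact is_syz_submod : submod_closed is_syz.
Proof.
split=> [|r x y /eqP x0 /eqP y0]; apply/eqP.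
  by rewrite big1 // => j _; rewrite mxE mulr0.
rewrite (eq_bigr (fun j => r * (a j * x 0 j) + a j * y 0 j)) => [|j _].
  by rewrite big_split /= -mulr_sumr x0 y0 mulr0 addr0.
by rewrite !mxE mulrDr mulrCA.
Qed.

HB.instance Definition _ := GRing.isSubmodClosed.Build R 'rV[R]_n is_syz
  (GRing.subsemimod_closed_submod is_syz_submod).

Record syz := Syz { syz_val :> 'rV[R]_n; _ : syz_val \in is_syz }.

HB.instance Definition _ := [isSub for syz_val].
HB.instance Definition _ := [Choice of syz by <:].
HB.instance Definition _ := [SubChoice_isSubLmodule of syz by <:].

(* v(i,j); the paper takes i != j, and for i = j this is 0. *)
Definition koszul_row (i j : 'I_n) : 'rV[R]_n :=
  a i *: delta_mx 0 j - a j *: delta_mx 0 i.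

Lemma koszul_rowE (i j k : 'I_n) : i != j ->
  koszul_row i j 0 k = if k == i then - a j else if k == j then a i else 0.
Proof.
move=> /negPf ij; rewrite !mxE !eqxx /=.
have [->|ki] := eqVneq k i; first by rewrite ij mulr0 mulr1 add0r.
by case: eqP; rewrite ?mulr1 !mulr0 subr0.
Qed.

Fact koszul_row_syz (i j : 'I_n) : koszul_row i j \in is_syz.
Proof.
have sumE (x : R) (l : 'I_n) :
    \sum_k a k * (x * (delta_mx 0 l : 'rV[R]_n) 0 k) = a l * x.
  rewrite (bigD1 l) //= mxE !eqxx mulr1 big1 ?addr0 // => k /negPf kl.
  by rewrite mxE kl andbF !mulr0.
apply/eqP; rewrite (eq_bigr (fun k =>
  a k * (a i * (delta_mx 0 j : 'rV[R]_n) 0 k) -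
  a k * (a j * (delta_mx 0 i : 'rV[R]_n) 0 k))) => [|k _].
  by rewrite sumrB !sumE mulrC subrr.
by rewrite -mulrBr !mxE.
Qed.

Definition koszul (i j : 'I_n) : syz := Syz (koszul_row_syz i j).

Definition koszul_span (i : 'I_n) : submodClosed syz :=
  span_of (fun j => j != i) (koszul i).

End Syzygies.

Definition lmod_iso (R : pzRingType) (U V : lmodType R) : Prop :=
  exists f : {linear U -> V}, bijective f.

(* Main.v *)
(** Write [b] for the family [a] without [a i].  The K-Hermite property gives an
    invertible [Q] with [b Q = (d, 0, ..., 0)]; then [Rb = Rd], so
    [r a_i + s d = 1] for some [r] and [s].  In the coordinates [y = Q z] on the
    entries other than the [i]-th one, a syzygy [(x_i, y)] is a solution of
    [a_i x_i + d z_0 = 0], and this forces [z_0 = a_i (r z_0 - s x_i)].  The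
    entries [z_1, ..., z_(n-2)] are free; reducing them modulo [a_i] is onto
    [(R / R a_i)^(n-2)], and its kernel consists of the syzygies with [y]
    divisible by [a_i], which is [S_i]. *)

Require Import Defs.
From mathcomp Require Import all_boot all_order all_algebra.
From HB Require Import structures.
From mathcomp Require Import boolp.

Set Implicit Arguments.
Unset Strict Implicit.
Unset Printing Implicit Defensive.

Import GRing.Theory.

Local Open Scope ring_scope.

Section FirstIsomorphism.
Variables (R : pzRingType) (V W : lmodType R) (N : submodClosed V).
Variable f : {linear V -> W}.
Hypothesis kerf : forall x, x \in N <-> f x = 0.

Definition quotmod_lift (u : quotmod N) : W := f (repr u).

(** The chosen representative differs from [x] by an element of [N], on which [f] vanishes. *)
Lemma quotmod_liftE x : quotmod_lift (quotmod_proj N x) = f x.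
Proof.
by apply/subr0_eq; rewrite -linearB; apply/kerf/quotmod_projP/quotmod_projE.
Qed.

Fact quotmod_lift_linear : linear quotmod_lift.
Proof.
move=> r u v; rewrite -[u]quotmod_projE -[v]quotmod_projE -linearP.
by rewrite !quotmod_liftE linearP.
Qed.

HB.instance Definition _ :=
  GRing.isLinear.Build R (quotmod N) W _ quotmod_lift quotmod_lift_linear.

Lemma quotmod_iso : (forall w, exists x, f x = w) -> lmod_iso (quotmod N) W.
Proof.
(* A section [g] of [f] need not be linear: projected to the quotient, it is the inverse of the
   lift. *)
move=> /choice[g fg]; exists quotmod_lift.
exists (fun w => quotmod_proj N (g w)) => [u|w]; last first.
  by rewrite /= quotmod_liftE.
rewrite -[RHS]quotmod_projE; apply/quotmod_projP/kerf.
by rewrite linearB fg subrr.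
Qed.

End FirstIsomorphism.

Lemma quotmod_proj_eq0 (R : pzRingType) (V : lmodType R) (N : submodClosed V)
    x : quotmod_proj N x = 0 <-> x \in N.
Proof. by rewrite -[0](linear0 (quotmod_proj N)) quotmod_projP subr0. Qed.

Section KoszulSpan.
Variables (R : comNzRingType) (m : nat) (a : 'I_m.+1 -> R) (i : 'I_m.+1).

Definition other_coefs : 'rV[R]_m := \row_k a (lift i k).

Lemma is_syz_lift (x : 'rV[R]_m.+1) :
  (x \in is_syz a) = (a i * x 0 i + (other_coefs *m (col' i x)^T) 0 0 == 0).
Proof.
rewrite [LHS]/in_mem /= /is_syz (bigD1_ord i) //= mxE.
by under [in RHS]eq_bigr do rewrite !mxE.
Qed.

(** Away from position [i], each v(i,j) has the single nonzero candidate a_i at j, so the entries of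
    the sum do not mix there. *)
Lemma koszul_sumE (c : 'I_m.+1 -> R) :
  let x := \sum_(j | j != i) c j *: koszul a i j in
  let c' := \row_k c (lift i k) in
  col' i (val x) = a i *: c' /\ val x 0 i = - (other_coefs *m c'^T) 0 0.
Proof.
move=> x c'.
have xE k : val x 0 k =
    \sum_(l < m) c (lift i l) * koszul_row a i (lift i l) 0 k.
  rewrite raddf_sum summxE big_mkcond.
  rewrite (bigD1_ord i) //= eqxx add0r.
  by apply: eq_bigr => l _; rewrite eq_sym neq_lift !mxE.
split.
  apply/rowP => l; rewrite !mxE xE (bigD1 l) //= big1 => [|k kl].
    rewrite koszul_rowE ?neq_lift // eqxx eq_sym (negPf (neq_lift _ _)).
    by rewrite addr0 mulrC.
  rewrite koszul_rowE ?neq_lift // eq_sym (negPf (neq_lift _ _)).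
  by rewrite (inj_eq lift_inj) eq_sym (negPf kl) mulr0.
rewrite xE mxE -sumrN; apply: eq_bigr => l _.
by rewrite koszul_rowE ?neq_lift // eqxx !mxE mulrN mulrC.
Qed.

Lemma syz_eq_lift (x y : syz a) :
  val x 0 i = val y 0 i -> col' i (val x) = col' i (val y) -> x = y.
Proof.
move=> eqi eqc; apply/val_inj/rowP => k; case: (unliftP i k) => [l|] -> //.
by have /rowP/(_ l) := eqc; rewrite !mxE.
Qed.

(** As a_i may be a zero divisor, the other entries fix x_i only modulo the annihilator of a_i;
    hence the separate equation for x_i. *)
Lemma koszul_spanP (x : syz a) :
  x \in koszul_span a i <-> exists c : 'rV[R]_m,
    col' i (val x) = a i *: c /\ val x 0 i = - (other_coefs *m c^T) 0 0.
Proof.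
split=> [/asboolP[c ->]|[c [xc xi]]].
  by exists (\row_k c (lift i k)); apply: koszul_sumE.
(* The value at [i] is arbitrary, since the sum skips that index. *)
pose c1 j := if unlift i j is Some k then c 0 k else 0.
have c1E : \row_k c1 (lift i k) = c.
  by apply/rowP => k; rewrite mxE /c1 liftK.
have [yc yi] := koszul_sumE c1; rewrite c1E in yc yi.
by apply/asboolP; exists c1; apply: syz_eq_lift; rewrite ?xi ?xc ?yi ?yc.
Qed.

End KoszulSpan.

Lemma principalP (R : pzRingType) (b x : R) :
  (x : R^o) \in principal b <-> exists r, x = r * b.
Proof. by split=> /asboolP. Qed.

Section FreeCoordinates.
Variables (R : comNzRingType) (m : nat) (a : 'I_m.+2 -> R) (i : 'I_m.+2).
Variables (Q Q' : 'M[R]_m.+1) (d : R).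
Hypotheses (QQ' : Q *m Q' = 1%:M) (Q'Q : Q' *m Q = 1%:M).
Hypothesis bQ : other_coefs a i *m Q = \row_j (if j == ord0 then d else 0).

(* The column [z] of the proof idea, transposed. *)
Definition coords (x : 'rV[R]_m.+2) : 'rV[R]_m.+1 := col' i x *m Q'^T.

Lemma coordsK x : coords x *m Q^T = col' i x.
Proof. by rewrite -mulmxA -trmx_mul QQ' trmx1 mulmx1. Qed.

(** This turns the syzygy equation into a_i x_i + d z_0 = 0, which leaves the later coordinates
    unconstrained. *)
Lemma other_coefs_mul (z : 'rV[R]_m.+1) :
  (other_coefs a i *m (z *m Q^T)^T) 0 0 = d * z 0 0.
Proof.
rewrite trmx_mul trmxK mulmxA bQ mxE big_ord_recl !mxE eqxx big1 ?addr0 //.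
by move=> k _; rewrite !mxE mul0r.
Qed.

Definition free_coords (x : syz a) :
    {ffun 'I_m -> quotmod (principal (a i))} :=
  [ffun k => quotmod_proj (principal (a i)) (coords (val x) 0 (lift 0 k))].

Fact free_coords_linear : linear free_coords.
Proof.
move=> r x y; apply/ffunP => k; rewrite !ffunE -linearP; congr quotmod_proj.
by rewrite /coords /= !linearP mulmxDl -scalemxAl !mxE.
Qed.

HB.instance Definition _ :=
  GRing.isLinear.Build R (syz a) _ _ free_coords free_coords_linear.

Lemma free_coords_surj w : exists x, free_coords x = w.
Proof.
(* With z_0 = 0 and x_i = 0 the equation holds for any choice of representatives of [w]. *)
pose z : 'rV[R]_m.+1 := \row_j (if unlift 0 j is Some k then repr (w k) else 0).
pose x : 'rV[R]_m.+2 :=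
  \row_j (if unlift i j is Some k then (z *m Q^T) 0 k else 0).
have xE : col' i x = z *m Q^T by apply/rowP => k; rewrite !mxE liftK mxE.
have xS : x \in is_syz a.
  rewrite (is_syz_lift _ i) xE other_coefs_mul !mxE !unlift_none.
  by rewrite !mulr0 addr0.
exists (Syz xS); apply/ffunP => k; rewrite ffunE /= /coords xE.
rewrite -mulmxA -trmx_mul Q'Q trmx1 mulmx1 mxE liftK.
exact: quotmod_projE.
Qed.

Hypothesis unimod : exists r s, r * a i + s * d = 1.

Lemma free_coords_ker x : x \in koszul_span a i <-> free_coords x = 0.
Proof.
rewrite koszul_spanP; split=> [[c [xc _]]|x0].
  apply/ffunP => k; rewrite !ffunE; apply/quotmod_proj_eq0/principalP.
  by rewrite /coords xc -scalemxAl mxE; eexists; apply: mulrC.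
have [r [s rs]] := unimod; pose z := coords (val x).
have syzE : a i * val x 0 i = - (d * z 0 0).
  have := valP x; rewrite (is_syz_lift _ i) -[col' i _]coordsK other_coefs_mul.
  by rewrite addr_eq0 => /eqP.
have /choice[c cE] (k : 'I_m) : exists ck, z 0 (lift 0 k) = ck * a i.
  apply/principalP/quotmod_proj_eq0.
  by have /ffunP/(_ k) := x0; rewrite !ffunE.
(* Multiplying r a_i + s d = 1 by z_0 and replacing d z_0 by - a_i x_i gives z_0 = a_i [z0]. *)
pose z0 := r * z 0 0 - s * val x 0 i.
pose w : 'rV[R]_m.+1 := \row_j (if unlift 0 j is Some k then c k else z0).
have zE : z = a i *: w.
  apply/rowP => j; rewrite [RHS]mxE [w _ _]mxE; case: unliftP => [k|] ->.
    by rewrite cE mulrC.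
  rewrite /z0 mulrBr [a i * (s * _)]mulrCA syzE mulrN opprK !mulrA -mulrDl.
  by rewrite [a i * r]mulrC rs mul1r.
exists (w *m Q^T); rewrite scalemxAl -zE coordsK; split=> //.
(* No cancellation of a_i is needed: - d [z0] = s d x_i - r d z_0 = (s d + r a_i) x_i = x_i. *)
rewrite other_coefs_mul mxE unlift_none /z0 mulrBr opprB.
rewrite [d * (r * _)]mulrCA -mulrN -syzE.
by rewrite !mulrA -mulrDl addrC [d * s]mulrC rs mul1r.
Qed.

End FreeCoordinates.

Theorem theorem3p2 (R : comNzRingType) (n : nat) (hn : (2 <= n)%N)
    (a : 'I_n -> R)
    (ha : forall x : R, exists c : 'I_n -> R, x = \sum_j c j * a j)
    (hR : KHermite R) (i : 'I_n) :
  lmod_iso (quotmod (koszul_span a i))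
           {ffun 'I_(n - 2) -> quotmod (principal (a i))}.
Proof.
case: n hn a ha i => [|[|m]] // _ a ha i; rewrite !subSS subn0.
have [Q [d [[Q' [QQ' Q'Q]] bQ]]] := hR m (other_coefs a i).
apply: (quotmod_iso (f := free_coords i Q')).
  apply: (free_coords_ker QQ' bQ).
  (* Since b = (d, 0, ..., 0) Q', every entry of b is d times an entry of the first row of Q', so a
     relation expressing 1 through [a] becomes one through a_i and d. *)
  have [c cE] := ha 1; exists (c i), (\sum_l c (lift i l) * Q' 0 l).
  rewrite cE (bigD1_ord i) //=; congr (_ + _); rewrite mulr_suml.
  apply: eq_bigr => l _; rewrite -mulrA; congr (_ * _).
  have /rowP/(_ l) : other_coefs a i = other_coefs a i *m Q *m Q'.
    by rewrite -mulmxA QQ' mulmx1.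
  rewrite bQ !mxE big_ord_recl !mxE eqxx big1 ?addr0 => [->|k _].
    exact: mulrC.
  by rewrite !mxE mul0r.
exact: (free_coords_surj Q'Q bQ).
Qed.
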